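(* Consider the causal adversarial multi-path network model with passive feedback described in the context, with $C$ unit-capacity links and overwrite jamming, where both reliability and perfect secrecy are required. For any $\vec z=(z_{rw},z_{ro},z_{wo})$ with $z_{rw}+z_{ro}+z_{wo}\le C$, the capacity for simultaneous reliability and secrecy is $$R=\max\{0,\ C-z_{ro}-z_{wo}-z_{rw}\}.$$
   Context: Model. A sender (Alice) communicates with a receiver (Bob) over $C$ parallel directed noiseless links $L_1,\dots,L_C$, each of unit capacity (large-alphabet regime). A code of block length $n$ and rate $R$ has message $M$ uniform on $\{0,1\}^{nR}$ and uses private randomness of Alice unknown to the adversary. Passive feedback: the code may operate in $r\ge1$ rounds of lengths summing to $n$; in round $k$ Alice's codewords $\vec X^{(k)}_1,\dots,\vec X^{(k)}_C$ are functions of the message, her randomness, and all words received by Bob in earlier rounds (Alice observes everything Bob receives, causally). Bob decodes $\hat M$ from all received words. Adversary. Calvin, who knows the coding scheme, selects pairwise disjoint link sets $Z_{rw},Z_{ro},Z_{wo}$ (unknown to Alice and Bob) with $|Z_{rw}|\le z_{rw}$, $|Z_{ro}|\le z_{ro}$, $|Z_{wo}|\le z_{wo}$; he reads the links in $Z_r=Z_{rw}\cup Z_{ro}$ and jams the links in $Z_w=Z_{rw}\cup Z_{wo}$. He is causal: his jamming at time $t$ may depend only on symbols observed on $Z_r$ up to time $t$. Under overwrite jamming $\vec Y_i=\vec E_i$ for $i\in Z_w$ (Calvin replaces the symbols with his own choice) and $\vec Y_i=\vec X_i$ otherwise. Reliability and secrecy. Rate $R$ is achievable if for every $\varepsilon>0$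 and all sufficiently large $n$ there is such a code with $\Pr[\hat M\ne M]<\varepsilon$ against every admissible causal adversary and such that the message is perfectly secret from Calvin, i.e. the mutual information between $M$ and everything Calvin observes on the links of $Z_r$ (over all rounds) is zero. The capacity is the supremum of achievable rates. *)

(* Defs.v *)
From Stdlib Require Import Reals Arith List Bool.
Open Scope R_scope.
Open Scope bool_scope.

Definition fsum (N : nat) (f : nat -> R) : R :=
  fold_right Rplus 0 (map f (seq 0 N)).

(** A word assigns a symbol (an element of {0,..,q-1}) to each (time, link). *)
Definition word := nat -> nat -> nat.

Definition restrict (h : word) (s : nat) : word :=
  fun u k => if (u <? s)%nat then h u k else 0%nat.

Definition win_eqb (n C : nat) (f g : word) : bool :=
  forallb (fun s => forallb (fun j => Nat.eqb (f s j) (g s j)) (seq 0 C)) (seq 0 n).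

(** Round structure: list of round lengths; [rstart ls t] = start time of the
    round containing time t. *)
Fixpoint rstart_from (ls : list nat) (off t : nat) : nat :=
  match ls with
  | nil => off
  | l :: ls' => if (t <? off + l)%nat then off else rstart_from ls' (off + l) t
  end.
Definition rstart (ls : list nat) (t : nat) : nat := rstart_from ls 0 t.

(** A code: alphabet size q, K messages (message set {0..K-1}),
    Alice's private randomness on {0..L-1} with weights w,
    round lengths, encoder and decoder. *)
Record code := Code {
  c_q : nat;
  c_K : nat;
  c_L : nat;
  c_w : nat -> R;
  c_rounds : list nat;
  (* message -> randomness -> words received by Bob so far -> time -> link -> symbol *)
  c_enc : nat -> nat -> word -> nat -> nat -> nat;
  c_dec : word -> nat
}.

Definition valid_code (C n : nat) (c : code) : Prop :=
  (2 <= c_q c)%nat /\ (1 <= c_K c)%nat /\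
  (forall i, (i < c_L c)%nat -> 0 <= c_w c i) /\
  fsum (c_L c) (c_w c) = 1 /\
  (1 <= length (c_rounds c))%nat /\
  fold_right plus 0%nat (c_rounds c) = n /\
  (forall m rho h t i, (t < n)%nat -> (i < C)%nat -> (c_enc c m rho h t i < c_q c)%nat) /\
  (* passive feedback: round-k codewords depend only on what Bob received
     in earlier rounds *)
  (forall m rho h h' t i,
      (forall s j, (s < rstart (c_rounds c) t)%nat -> h s j = h' s j) ->
      c_enc c m rho h t i = c_enc c m rho h' t i).

(** Adversary: the three link sets and a jamming strategy
    (observations -> time -> link -> symbol). *)
Record adversary := Adv {
  a_rw : nat -> bool;
  a_ro : nat -> bool;
  a_wo : nat -> bool;
  a_strat : word -> nat -> nat -> nat
}.

Definition a_r (a : adversary) (i : nat) : bool := a_rw a i || a_ro a i.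
Definition a_w (a : adversary) (i : nat) : bool := a_rw a i || a_wo a i.

Definition nlinks (C : nat) (Z : nat -> bool) : nat := length (filter Z (seq 0 C)).

Definition valid_adv (C q zrw zro zwo : nat) (a : adversary) : Prop :=
  (forall i, a_rw a i = true -> (i < C)%nat) /\
  (forall i, a_ro a i = true -> (i < C)%nat) /\
  (forall i, a_wo a i = true -> (i < C)%nat) /\
  (forall i, a_rw a i && a_ro a i = false) /\
  (forall i, a_rw a i && a_wo a i = false) /\
  (forall i, a_ro a i && a_wo a i = false) /\
  (nlinks C (a_rw a) <= zrw)%nat /\
  (nlinks C (a_ro a) <= zro)%nat /\
  (nlinks C (a_wo a) <= zwo)%nat /\
  (forall obs t i, (a_strat a obs t i < q)%nat).

(** Calvin's observation up to (and including) time t, given Bob's received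
    words [h] before time t: Alice's symbols on the read links. *)
Definition obs_upto (c : code) (a : adversary) (m rho : nat) (h : word) (t : nat) : word :=
  fun s j => if (s <=? t)%nat && a_r a j then c_enc c m rho (restrict h s) s j else 0%nat.

(** [hist C c a m rho t] = words received by Bob at times < t (0 elsewhere). *)
Fixpoint hist (C : nat) (c : code) (a : adversary) (m rho : nat) (t : nat) : word :=
  match t with
  | O => fun _ _ => 0%nat
  | S t' =>
      let h := hist C c a m rho t' in
      fun s j =>
        if (s <? t')%nat then h s j
        else if (s =? t')%nat then
          (if (j <? C)%nat then
             (if a_w a j then a_strat a (obs_upto c a m rho h t') t' j
              else c_enc c m rho h t' j)
           else 0%nat)
        else 0%nat
  end.

Definition view (C n : nat) (c : code) (a : adversary) (m rho : nat) : word :=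
  let Y := hist C c a m rho n in
  fun s j => if (s <? n)%nat && a_r a j then c_enc c m rho (restrict Y s) s j else 0%nat.

Definition ind (b : bool) : R := if b then 1 else 0.

Definition err_prob (C n : nat) (c : code) (a : adversary) : R :=
  fsum (c_K c) (fun m => fsum (c_L c) (fun r =>
    / INR (c_K c) * c_w c r * ind (negb (Nat.eqb (c_dec c (hist C c a m r n)) m)))).

Definition p_joint (C n : nat) (c : code) (a : adversary) (m : nat) (v : word) : R :=
  fsum (c_L c) (fun r => / INR (c_K c) * c_w c r * ind (win_eqb n C (view C n c a m r) v)).

Definition p_view (C n : nat) (c : code) (a : adversary) (v : word) : R :=
  fsum (c_K c) (fun m => p_joint C n c a m v).

Definition perfectly_secret (C n : nat) (c : code) (a : adversary) : Prop :=
  forall m v, (m < c_K c)%nat ->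
    p_joint C n c a m v = / INR (c_K c) * p_view C n c a v.

(** Rate R (normalised so each link has unit capacity, i.e. log q per use)
    is achievable. *)
Definition achievable (C zrw zro zwo : nat) (R : R) : Prop :=
  forall eps, 0 < eps ->
  exists N, forall n, (N <= n)%nat ->
  exists c : code,
    valid_code C n c /\
    Rpower (INR (c_q c)) (INR n * R) <= INR (c_K c) /\
    forall a, valid_adv C (c_q c) zrw zro zwo a ->
      err_prob C n c a < eps /\ perfectly_secret C n c a.

(* Main.v *)
(** Converse: Calvin overwrites the links of [Z_rw] and [Z_wo] with a constant.
    Bob's word is then a function of Calvin's view, which secrecy makes
    independent of the message, and of the at most [q ^ (n * D)] contents of
    the [D = C - zrw - zro - zwo] links that Calvin does not touch.  Guessing a
    uniform message among [K] from these data succeeds with probability at most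
    [q ^ (n * D) / K].

    Achievability for [D > 0], with rounds of length one.  A block of [D]
    symbols is sent as a random vector [X] with [G X = block], where [G] is
    Vandermonde and [X] vanishes on the links already caught jamming.  By
    feedback Alice sees whether the block arrived intact; if not, at least one
    new link has been caught, and she repeats the block without it, so at most
    [C] slots are wasted.  Then random keys are sent on all links: the sums of
    the symbols that Bob received are known to Alice by feedback and unknown to
    Calvin, since some link is untouched.  They key a one-time authentication
    tag for the report telling Bob where the intact blocks are; the report and
    its tag are repeated on every link, and Calvin forges a tag with probability
    at most [C / q].  Secrecy: a shift of the padding supported on untouched
    links turns an execution for one message into one for any other message
    with the same view. *)
Require Import Defs.
From Stdlib Require Import Reals.
Open Scope R_scope.

From mathcomp Require all_boot all_order all_algebra.
From mathcomp Require reals_stdlib.Rstruct.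
From mathcomp Require zify ring.

Module Capacity.
Import all_boot all_order all_algebra Rstruct zify ring.
Set Implicit Arguments.
Unset Strict Implicit.
Unset Printing Implicit Defensive.
Import Order.TTheory GRing.Theory Num.Theory.
Local Open Scope ring_scope.

(** * Numbering of finite types, since messages, randomness and symbols of a [code] are naturals *)

Section Enumeration.
Variables (T : finType) (x0 : T).

Definition rank (x : T) : nat := enum_rank x.
Definition unrank (k : nat) : T := nth x0 (enum T) k.

Lemma rankK : cancel rank unrank.
Proof. by move=> x; rewrite /unrank /rank nth_enum_rank. Qed.

Lemma rank_lt x : (rank x < #|T|)%N.
Proof. exact: ltn_ord. Qed.

Lemma unrankK k : (k < #|T|)%N -> rank (unrank k) = k.
Proof.
move=> lt_k; rewrite /rank /unrank -[k]/(nat_of_ord (Ordinal lt_k)).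
by rewrite -enum_val_nth enum_valK.
Qed.

End Enumeration.

(** * Translation of the vocabulary of the model into MathComp terms *)

Lemma ltbE m n : Nat.ltb m n = (m < n)%N.
Proof. by apply/idP/idP=> [/Nat.ltb_lt/ssrnat.ltP|/ssrnat.ltP/Nat.ltb_lt]. Qed.

Lemma lebE m n : Nat.leb m n = (m <= n)%N.
Proof. by apply/idP/idP=> [/Nat.leb_le/ssrnat.leP|/ssrnat.leP/Nat.leb_le]. Qed.

Lemma natEqbE m n : Nat.eqb m n = (m == n)%N.
Proof. by apply/idP/idP=> [/Nat.eqb_eq/eqP|/eqP/Nat.eqb_eq]. Qed.

Lemma list_seqE a n : List.seq a n = iota a n.
Proof. by elim: n a => //= n IHn a; rewrite IHn. Qed.

Lemma fsumE N f : fsum N f = \sum_(i < N) f i.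
Proof.
rewrite /fsum list_seqE -(big_mkord xpredT f) /index_iota subn0.
elim: (iota 0 N) => [|i s IHs] /=; first by rewrite big_nil.
by rewrite big_cons IHs.
Qed.

Lemma fsum_rank (T : finType) f : fsum #|T| f = \sum_(x : T) f (rank x).
Proof. by rewrite fsumE (reindex (@enum_rank T)) //; apply/onW_bij/enum_rank_bij. Qed.

Lemma fsum_const_prob (T : finType) : (0 < #|T|)%N ->
  fsum #|T| (fun=> (INR #|T|)^-1) = 1.
Proof.
move=> T_gt0; rewrite fsumE sumr_const card_ord INRE.
by rewrite -[LHS]mulr_natr mulVf // pnatr_eq0 -lt0n.
Qed.

Lemma indE (b : bool) : Defs.ind b = b%:R.
Proof. by case: b. Qed.

Lemma win_eqbP n C f g :
  reflect (forall s j, (s < n)%N -> (j < C)%N -> f s j = g s j)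
          (win_eqb n C f g).
Proof.
have forallbE T (p : T -> bool) l : List.forallb p l = all p l.
  by elim: l => //= x l ->.
rewrite /win_eqb forallbE !list_seqE; apply: (iffP allP) => [fg s j lt_sn lt_jC|fg s].
  have := fg s; rewrite mem_iota lt_sn forallbE => /(_ isT)/allP/(_ j).
  by rewrite mem_iota lt_jC natEqbE => /(_ isT)/eqP.
rewrite mem_iota add0n forallbE => lt_sn; apply/allP => j.
by rewrite mem_iota natEqbE => lt_jC; apply/eqP/fg.
Qed.

Lemma nlinks_card C (Z : nat -> bool) : nlinks C Z = #|[set i : 'I_C | Z i]|.
Proof.
rewrite /nlinks list_seqE -val_enum_ord cardE /enum_mem -enumT.
elim: (enum 'I_C) => //= i s IHs; rewrite inE.
by case: (Z i) => //=; rewrite IHs.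
Qed.

Lemma word_ext (f g : word) : (forall s j, f s j = g s j) -> f = g.
Proof.
by move=> fg; apply: FunctionalExtensionality.functional_extensionality => s;
   apply: FunctionalExtensionality.functional_extensionality => j.
Qed.

Lemma rstart_from_le ls off t : (off <= t)%N -> (rstart_from ls off t <= t)%N.
Proof.
elim: ls off => //= l ls IHls off le_off; rewrite ltbE.
by case: ltnP => // le_offl; apply: IHls.
Qed.

Lemma rstart_unit n t : rstart (List.repeat 1%N n) t = minn t n.
Proof.
rewrite /rstart; suff H off : (off <= t)%N ->
    rstart_from (List.repeat 1%N n) off t = minn t (off + n).
  by rewrite H // add0n.
elim: n off => /= [|n IHn] off le_off; first by lia.
rewrite ltbE; case: ltnP; first by lia.
by move=> le_off1; rewrite IHn; lia.
Qed.

Lemma card_gt0 (X : finType) : X -> (0 < #|X|)%N.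
Proof. by move=> x; apply/card_gt0P; exists x. Qed.

(** * Executions of a code *)

Section Run.
Variables (C : nat) (c : code) (a : adversary) (n : nat).
Hypothesis causal : forall m rho h h' t i,
  (forall s j, (s < t)%N -> h s j = h' s j) -> c_enc c m rho h t i = c_enc c m rho h' t i.
Hypothesis reads_links : forall j, a_r a j -> (j < C)%N.

Definition received m rho := hist C c a m rho n.
Definition sent m rho := c_enc c m rho (received m rho).

Lemma hist_prefix m rho t t' s j : (s < t)%N -> (t <= t')%N ->
  hist C c a m rho t' s j = hist C c a m rho t s j.
Proof.
move=> lt_st; elim: t' => [|t' IHt']; first by case: t lt_st.
rewrite leq_eqVlt => /orP[/eqP <- //|le_tt'] /=.
by rewrite ltbE (leq_trans lt_st le_tt') IHt'.
Qed.

Lemma hist_outside m rho t s j : ~~ ((s < t)%N && (j < C)%N) ->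
  hist C c a m rho t s j = 0%N.
Proof.
elim: t => //= t IHt; rewrite !ltbE natEqbE ltnS leq_eqVlt.
by case: ltngtP => [lt_st|_|_] //= => [|/negPf->] // /negPf H; apply: IHt; rewrite lt_st H.
Qed.

Lemma received_outside m rho s j : ~~ ((s < n)%N && (j < C)%N) ->
  received m rho s j = 0%N.
Proof. exact: hist_outside. Qed.

Lemma enc_restrict m rho h s j :
  c_enc c m rho (restrict h s) s j = c_enc c m rho h s j.
Proof. by apply: causal => u k lt_us; rewrite /restrict ltbE lt_us. Qed.

(** By causality, what Calvin sees while the word is still growing can be read off the finished
    execution; this removes the recursion of [hist] from later arguments. *)
Lemma obs_uptoE m rho t : (t <= n)%N ->
  obs_upto c a m rho (hist C c a m rho t) t
  = fun s j => if (s <= t)%N && a_r a j then sent m rho s j else 0%N.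
Proof.
move=> le_tn; apply: word_ext => s j; rewrite /obs_upto lebE.
case: leqP => //= le_st; case: (a_r a j) => //; rewrite enc_restrict.
by apply: causal => u k lt_us; rewrite /received (@hist_prefix _ _ t n) //; lia.
Qed.

Lemma receivedE m rho s j : (s < n)%N -> (j < C)%N ->
  received m rho s j =
  if a_w a j
  then a_strat a (fun u k => if (u <= s)%N && a_r a k then sent m rho u k else 0%N) s j
  else sent m rho s j.
Proof.
move=> lt_sn lt_jC; rewrite /received (@hist_prefix _ _ s.+1) //= !ltbE natEqbE.
rewrite ltnn eqxx lt_jC obs_uptoE ?(ltnW lt_sn) //; case: (a_w a j) => //.
by apply: causal => u k lt_us; rewrite /received (@hist_prefix _ _ s n) // ltnW.
Qed.

Lemma received_clean m rho s j : (s < n)%N -> (j < C)%N -> ~~ a_w a j ->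
  received m rho s j = sent m rho s j.
Proof. by move=> lt_sn lt_jC /negPf aw; rewrite receivedE // aw. Qed.

Lemma viewE m rho s j :
  view C n c a m rho s j = if (s < n)%N && a_r a j then sent m rho s j else 0%N.
Proof. by rewrite /view ltbE enc_restrict. Qed.

Section Coupling.
Variables (U : pred nat) (m rho m' rho' : nat).
Hypothesis U_unread : forall j, U j -> ~~ a_r a j.
Hypothesis sent_agree : forall t, (t < n)%N ->
  (forall s j, (s < t)%N -> ~~ U j -> received m rho s j = received m' rho' s j) ->
  forall j, (j < C)%N -> ~~ U j -> sent m rho t j = sent m' rho' t j.

(** Induction on time. A jammed symbol is a function of what Calvin has read, the current slot
    included, and he reads nothing in [U]; so a difference confined to [U] never reaches another
    link through him. *)
Lemma received_agree t s j : (t <= n)%N -> (s < t)%N -> ~~ U j ->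
  received m rho s j = received m' rho' s j.
Proof.
elim: t s j => // t IHt s j lt_tn; rewrite ltnS leq_eqVlt => /orP[/eqP->|]; last first.
  by apply: IHt; exact: ltnW.
move=> Uj; have [lt_jC|ge_jC] := ltnP j C; last first.
  by rewrite !received_outside // [(j < C)%N]ltnNge ge_jC andbF.
have IH u k : (u < t)%N -> ~~ U k -> received m rho u k = received m' rho' u k.
  by apply: IHt; exact: ltnW.
rewrite !receivedE //; case: ifP => _; last exact: sent_agree.
congr (a_strat a _ t j); apply: word_ext => u k.
case: leqP => //= le_ut; case: ifP => // ark.
apply: sent_agree; first exact: leq_ltn_trans lt_tn.
- by move=> v l lt_vu; apply: IH; exact: leq_trans le_ut.
- exact: reads_links.
- by apply: contraL ark; exact: U_unread.
Qed.

Lemma view_agree : view C n c a m rho = view C n c a m' rho'.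
Proof.
apply: word_ext => s j; rewrite !viewE; case: ltnP => //= lt_sn; case: ifP => // arj.
apply: sent_agree => //; last by apply: contraL arj; exact: U_unread.
- by move=> u k lt_us; apply: (@received_agree s) => //; exact: ltnW.
- exact: reads_links.
Qed.

End Coupling.
End Run.

(** * Linear algebra over a field *)

(** Any [D] columns indexed by [W] form a square Vandermonde matrix at distinct points. Its inverse,
    spread over these coordinates by [P], is the right inverse. *)
Lemma vandermonde_right_inverse (F : fieldType) (C D : nat) (alpha : 'rV[F]_C)
    (W : {set 'I_C}) :
  injective (alpha 0) -> (D <= #|W|)%N ->
  exists L : 'M[F]_(C, D),
    Vandermonde D alpha *m L = 1%:M /\ forall i k, i \notin W -> L i k = 0.
Proof.
move=> alpha_inj le_DW.
have inW : forall k : 'I_D, enum_val (widen_ord le_DW k) \in W by move=> k; apply: enum_valP.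
pose f (k : 'I_D) := enum_val (widen_ord le_DW k).
have f_inj : injective f by move=> k l /enum_val_inj/(congr1 val)/= kl; apply: val_inj.
pose P : 'M[F]_(C, D) := \matrix_(i, k) (i == f k)%:R.
have VP : Vandermonde D alpha *m P = Vandermonde D (\row_k alpha 0 (f k)).
  apply/matrixP => i k; rewrite !mxE (bigD1 (f k)) //= !mxE eqxx mulr1 big1 ?addr0 //.
  by move=> j /negPf jk; rewrite !mxE jk mulr0.
have Vu : Vandermonde D (\row_k alpha 0 (f k)) \in unitmx.
  rewrite unitmxE det_Vandermonde unitfE; apply/prodf_neq0 => i _.
  apply/prodf_neq0 => j lt_ij; rewrite !mxE subr_eq0; apply: contraTneq lt_ij.
  by move=> /alpha_inj/f_inj ->; rewrite ltnn.
exists (P *m invmx (Vandermonde D (\row_k alpha 0 (f k)))); split.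
  by rewrite mulmxA VP mulmxV.
move=> i k iW; rewrite mxE big1 // => j _; rewrite mxE.
by case: eqP iW => [->|_ _]; rewrite ?inW // mul0r.
Qed.

(** Soundness of the one-time tag: a forgery together with the genuine tag
    determines the key. *)
Lemma affine_unique (F : fieldType) (x y a b a' b' : F) : x != y ->
  a * y + b = a' * y + b' -> a * x + b = a' * x + b' -> a = a' /\ b = b'.
Proof.
rewrite -subr_eq0 => nz_xy eq_y eq_x; have eqa : a = a'.
  apply/(mulIf nz_xy)/(addIr (a * y + b)); rewrite {2}eq_y.
  have -> : a * (x - y) + (a * y + b) = a * x + b by ring.
  by rewrite eq_x; ring.
by split=> //; move: eq_y; rewrite eqa => /addrI.
Qed.

(** * The authenticated retransmission scheme *)

Section Scheme.

Variables (F : finFieldType) (C' D B T : nat).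
Local Notation C := C'.+1.
Variables (G : 'M[F]_(D, C)) (L : {set 'I_C} -> 'M[F]_(C, D)).
Hypothesis mulGL : forall W : {set 'I_C}, (D <= #|W|)%N -> G *m L W = 1%:M.
Hypothesis L_support :
  forall (W : {set 'I_C}) i k, (D <= #|W|)%N -> i \notin W -> L W i k = 0.

Definition mask (J : {set 'I_C}) (r : 'cV[F]_C) : 'cV[F]_C :=
  \col_i (if i \in J then 0 else r i 0).

(** A solution [X] of [G X = x] vanishing on [J]: the padding [r], corrected on
    the links outside [J]. *)
Definition share (J : {set 'I_C}) (x : 'cV[F]_D) (r : 'cV[F]_C) : 'cV[F]_C :=
  mask J r + L (~: J) *m (x - G *m mask J r).

Lemma mask_id (J : {set 'I_C}) (r : 'cV[F]_C) : (forall i, i \in J -> r i 0 = 0) -> mask J r = r.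
Proof. by move=> rJ; apply/colP => i; rewrite mxE; case: ifP => // /rJ. Qed.

Lemma maskD J r s : mask J (r + s) = mask J r + mask J s.
Proof. by apply/colP => i; rewrite !mxE; case: ifP => //; rewrite addr0. Qed.

Lemma mulmx_L_support (W : {set 'I_C}) (e : 'cV_D) i : (D <= #|W|)%N -> i \notin W ->
  (L W *m e) i 0 = 0.
Proof. by move=> DW iW; rewrite mxE big1 // => k _; rewrite L_support // mul0r. Qed.

Lemma mul_share (J : {set 'I_C}) x r : (D <= #|~: J|)%N -> G *m share J x r = x.
Proof.
by move=> DJ; rewrite /share mulmxDr mulmxA mulGL // mul1mx addrC subrK.
Qed.

Lemma mask_share (J : {set 'I_C}) x r : (D <= #|~: J|)%N -> mask J (share J x r) = share J x r.
Proof.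
move=> DJ; apply: mask_id => i iJ.
by rewrite /share mxE mulmx_L_support // ?inE ?iJ // mxE iJ addr0.
Qed.

(** The added padding already contributes [G *m (L U *m e) = e], so the correction term is
    unchanged. Hence the data can be altered by [e] at the cost of a change seen on [U] only. *)
Lemma share_shift (U J : {set 'I_C}) x e r : (D <= #|U|)%N -> [disjoint U & J] ->
  share J (x + e) (r + L U *m e) = share J x r + L U *m e.
Proof.
move=> DU UJ; have Emask : mask J (r + L U *m e) = mask J r + L U *m e.
  rewrite maskD [mask J (L U *m e)]mask_id // => i iJ.
  by rewrite mulmx_L_support // (disjointFl UJ).
rewrite /share Emask [G *m (_ + _)]mulmxDr [G *m (_ *m _)]mulmxA mulGL // mul1mx.
by rewrite opprD addrACA subrr addr0 addrAC.
Qed.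

Definition message := {ffun 'I_B.+1 -> 'cV[F]_D}.
Definition padding := {ffun 'I_B.+1 -> 'cV[F]_C}.
Definition keys := ('cV[F]_C * 'cV[F]_C)%type.
Definition report := {ffun 'I_B.+1 -> option ('I_T * {set 'I_C})}.
Implicit Types (m : message) (d : padding) (k : keys) (y : nat -> 'cV[F]_C) (U J : {set 'I_C}).

(** Once all blocks are delivered, [inord] falls back to block 0, which is then
    sent again to no effect. *)
Definition block m d (st : {set 'I_C} * nat) : 'cV[F]_C :=
  share st.1 (m (inord st.2)) (d (inord st.2)).

(** The links caught jamming before time [t] and the number of delivered blocks,
    as Alice computes them from the received word [y]. *)
Fixpoint state m d y t : {set 'I_C} * nat :=
  if t is t'.+1 then
    let st := state m d y t' in
    let J := st.1 :|: [set i | block m d st i 0 != y t' i 0] in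
    (J, st.2 + (J == st.1))%N
  else (set0, 0%N).

Definition jammed m d y t := (state m d y t).1.
Definition delivered m d y t := (state m d y t).2.
Definition data m d y t := block m d (state m d y t).

Lemma jammedS m d y t :
  jammed m d y t.+1 = jammed m d y t :|: [set i | data m d y t i 0 != y t i 0].
Proof. by []. Qed.

Lemma deliveredS m d y t :
  delivered m d y t.+1 = (delivered m d y t + (jammed m d y t.+1 == jammed m d y t))%N.
Proof. by []. Qed.

(** For each block, the slot in which it arrived intact and the links already
    caught at that time. *)
Definition make_report m d y : report := [ffun b : 'I_B.+1 =>
  [pick p : 'I_T * {set 'I_C} |
    [&& delivered m d y p.1 == b, delivered m d y p.1.+1 == b.+1 & jammed m d y p.1 == p.2]]].

Definition read_report (s : report) y : message := [ffun b =>
  if s b is Some p then G *m mask p.2 (y p.1) else 0].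

Definition clean_data m d U y t :=
  forall s i, (s < t)%N -> i \in U -> y s i 0 = data m d y s i 0.

Lemma jammed_clean m d U y t : clean_data m d U y t -> [disjoint U & jammed m d y t].
Proof.
move=> clean; rewrite disjoints_subset; apply/subsetP => i iU; rewrite inE.
elim: t clean => [|t IHt] clean; first by rewrite inE.
rewrite jammedS !inE negb_or negbK (clean t) // eqxx andbT.
by apply: IHt => s j lt_st; apply: clean; exact: ltnW.
Qed.

Lemma unjammed_ge m d U y t : (D <= #|U|)%N -> clean_data m d U y t ->
  (D <= #|~: jammed m d y t|)%N.
Proof.
move=> DU /jammed_clean; rewrite disjoints_subset => UJ.
exact: leq_trans DU (subset_leq_card UJ).
Qed.

(** Each slot either delivers a block or catches at least one new link. *)
Lemma progress m d y t : (t <= #|jammed m d y t| + delivered m d y t)%N.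
Proof.
elim: t => // t IHt; rewrite deliveredS.
have sub : jammed m d y t \subset jammed m d y t.+1 by rewrite jammedS subsetUl.
case: eqP => [->|/eqP neqJ]; first by rewrite addn1 addnS ltnS.
have : (#|jammed m d y t| < #|jammed m d y t.+1|)%N.
  by apply: proper_card; rewrite properEneq sub andbT eq_sym.
lia.
Qed.

Lemma delivery_time m d y b : (b < delivered m d y T)%N ->
  exists2 t, (t < T)%N & delivered m d y t = b /\ delivered m d y t.+1 = b.+1.
Proof.
elim: T => // t IHt lt_b; have [/IHt[t' lt_t' eqt']|le_b] := ltnP b (delivered m d y t).
  by exists t' => //; exact: ltnW.
exists t => //; move: lt_b; rewrite deliveredS; case: (_ == _) => /=; lia.
Qed.

Lemma read_reportK m d U y : (B.+1 + C <= T)%N -> (D <= #|U|)%N -> clean_data m d U y T ->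
  read_report (make_report m d y) y = m.
Proof.
move=> le_T DU clean; apply/ffunP => b; rewrite ffunE /make_report ffunE.
case: pickP => [[t J] /and3P[/= /eqP kt /eqP kt1 /eqP <-]|nopick].
  have DJ : (D <= #|~: jammed m d y t|)%N.
    apply: unjammed_ge DU _ => s i lt_st; apply: clean; exact: ltn_trans (ltn_ord t).
  have -> : mask (jammed m d y t) (y t) = data m d y t.
    have <- : mask (jammed m d y t) (data m d y t) = data m d y t by exact: mask_share.
    apply/colP => i; rewrite [LHS]mxE [RHS]mxE; case: ifPn => // iJ.
    (* The count rose in this slot, so no new link was caught: outside the known set the received
       vector is the one sent. *)
    move: kt1; rewrite deliveredS kt; case: eqP => [eqJ _|_]; last by rewrite addn0; lia.
    by apply/eqP; apply: contraNT iJ => neq; rewrite -eqJ jammedS !inE eq_sym neq orbT.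
  rewrite /data /block mul_share // -/(delivered m d y t) kt.
  by congr (m _); apply: val_inj; rewrite /= inordK.
(* At most [C] of the [T] slots are wasted, so all [B.+1] blocks are delivered. *)
have [|t lt_tT [kt kt1]] := @delivery_time m d y b.
  have le_C : (#|jammed m d y T| <= C)%N by rewrite -[leqRHS]card_ord max_card.
  have := progress m d y T; have := ltn_ord b; lia.
by have := nopick (Ordinal lt_tT, jammed m d y t); rewrite /= kt kt1 !eqxx.
Qed.

Lemma state_causal m d y y' t : (forall s, (s < t)%N -> y s = y' s) ->
  state m d y t = state m d y' t.
Proof.
elim: t => //= t IHt yy'; rewrite IHt => [|s lt_st]; last by apply: yy'; exact: ltnW.
by rewrite yy'.
Qed.

Lemma make_report_causal m d y y' : (forall s, (s < T)%N -> y s = y' s) ->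
  make_report m d y = make_report m d y'.
Proof.
move=> yy'; apply/ffunP => b; rewrite !ffunE; apply: eq_pick => -[t J] /=.
rewrite /delivered /jammed.
have [E E1] : state m d y t = state m d y' t /\ state m d y t.+1 = state m d y' t.+1.
  by split; apply: state_causal => s lt_s; apply: yy'; apply: leq_trans lt_s _ => //; exact: ltnW.
by rewrite E E1.
Qed.

(** The padding is indexed by block and not by time, so that this shift does not
    depend on how the transmission unfolds. *)
Definition shift U m m' d : padding := [ffun b => d b + L U *m (m' b - m b)].

Lemma block_shift U m m' d J b : (D <= #|U|)%N -> [disjoint U & J] ->
  block m' (shift U m m' d) (J, b) =
  block m d (J, b) + L U *m (m' (inord b) - m (inord b)).
Proof.
by move=> DU UJ; rewrite /block /= ffunE -share_shift // [m _ + _]addrC subrK.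
Qed.

Lemma block_shift_outside U m m' d J b i : (D <= #|U|)%N -> [disjoint U & J] ->
  i \notin U -> block m' (shift U m m' d) (J, b) i 0 = block m d (J, b) i 0.
Proof.
by move=> DU UJ iU; rewrite block_shift // [LHS]mxE mulmx_L_support // addr0.
Qed.

(** On [U] neither execution shows a mismatch; off [U] the shift changes no symbol of the block and
    the received words agree. So both executions catch the same links in every slot. *)
Lemma state_shift U m m' d y y' t : (D <= #|U|)%N ->
  clean_data m d U y t -> clean_data m' (shift U m m' d) U y' t ->
  (forall s i, (s < t)%N -> i \notin U -> y s i 0 = y' s i 0) ->
  state m d y t = state m' (shift U m m' d) y' t.
Proof.
move=> DU; elim: t => // t IHt clean clean' yy'.
have IH : state m d y t = state m' (shift U m m' d) y' t.
  by apply: IHt => s i lt_st; [apply: clean|apply: clean'|apply: yy']; exact: ltnW.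
have UJ : [disjoint U & jammed m d y t].
  by apply: jammed_clean => s i lt_st; apply: clean; exact: ltnW.
have := fun i => clean t i (ltnSn t); have := fun i => clean' t i (ltnSn t).
rewrite /= /data -IH; rewrite /jammed in UJ; case: (state m d y t) UJ => J b /= UJ c' c.
suff -> : [set i | block m d (J, b) i 0 != y t i 0] =
          [set i | block m' (shift U m m' d) (J, b) i 0 != y' t i 0] by [].
apply/setP => i; rewrite !inE; have [iU|iU] := boolP (i \in U).
  by rewrite c // c' // !eqxx.
by rewrite yy' // block_shift_outside.
Qed.

Lemma data_shift U m m' d y y' t i : (D <= #|U|)%N ->
  clean_data m d U y t -> clean_data m' (shift U m m' d) U y' t ->
  (forall s i, (s < t)%N -> i \notin U -> y s i 0 = y' s i 0) ->
  i \notin U -> data m d y t i 0 = data m' (shift U m m' d) y' t i 0.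
Proof.
move=> DU clean clean' yy' iU; have /= := jammed_clean clean.
rewrite /data -(state_shift DU clean clean' yy') /jammed.
case: (state m d y t) => J b /= UJ.
by rewrite block_shift_outside.
Qed.

Lemma make_report_shift U m m' d y y' : (D <= #|U|)%N ->
  clean_data m d U y T -> clean_data m' (shift U m m' d) U y' T ->
  (forall s i, (s < T)%N -> i \notin U -> y s i 0 = y' s i 0) ->
  make_report m d y = make_report m' (shift U m m' d) y'.
Proof.
move=> DU clean clean' yy'; apply/ffunP => b; rewrite !ffunE; apply: eq_pick => -[t J] /=.
have E u : (u <= T)%N -> state m d y u = state m' (shift U m m' d) y' u.
  move=> le_u; apply: state_shift => // s i lt_s.
  - by apply: clean; exact: leq_trans le_u.
  - by apply: clean'; exact: leq_trans le_u.
  - by apply: yy'; exact: leq_trans le_u.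
by rewrite /delivered /jammed !E // ltnW.
Qed.

(** * The complete code: data, key, report and tag slots *)

Variable n : nat.
(** After the [T] data slots come two key slots, one report slot and one tag slot. *)
Hypothesis n_def : n = T.+4.
Hypothesis report_fits : (#|{: report}| <= #|F|)%N.

(** The alphabet is assumed so large that one symbol carries the whole report. *)
Definition embed (s : report) : F := unrank 0 (rank s).
Definition unembed (x : F) : report := unrank [ffun=> None] (rank x).

Lemma embedK : cancel embed unembed.
Proof.
move=> s; rewrite /unembed /embed unrankK ?rankK //.
exact: leq_trans (rank_lt s) report_fits.
Qed.

Definition total (v : 'cV[F]_C) : F := \sum_i v i 0.
(** The key is made of the symbols that Bob received, jammed or not. *)
Definition tag y (s : F) : F := total (y T) * s + total (y T.+1).

Definition encode m d k y t : 'cV[F]_C :=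
  if (t < T)%N then data m d y t
  else if t == T then k.1
  else if t == T.+1 then k.2
  else let s := embed (make_report m d y) in
       if t == T.+2 then const_mx s else const_mx (tag y s).

Definition decode y : message :=
  if [pick i | y T.+3 i 0 == tag y (y T.+2 i 0)] is Some i
  then read_report (unembed (y T.+2 i 0)) y else [ffun=> 0].

Lemma encode_data m d k y t : (t < T)%N -> encode m d k y t = data m d y t.
Proof. by rewrite /encode => ->. Qed.

Lemma encode_key1 m d k y : encode m d k y T = k.1.
Proof. by rewrite /encode ltnn eqxx. Qed.

Lemma encode_key2 m d k y : encode m d k y T.+1 = k.2.
Proof. by rewrite /encode ltnNge leqnSn eqxx gtn_eqF. Qed.

Lemma encode_report m d k y : encode m d k y T.+2 = const_mx (embed (make_report m d y)).
Proof. by rewrite /encode eqxx ifF 1?ifF 1?ifF //; lia. Qed.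

Lemma encode_tag m d k y t : (T.+2 < t)%N ->
  encode m d k y t = const_mx (tag y (embed (make_report m d y))).
Proof. by move=> lt_t; rewrite /encode ifF 1?ifF 1?ifF 1?ifF //; lia. Qed.

(** With unit rounds, [minn t n] is the start of the round containing [t], as computed by [rstart];
    it stays at [n] past the end of the block. *)
Lemma encode_causal m d k y y' t :
  (forall s, (s < minn t n)%N -> y s = y' s) -> encode m d k y t = encode m d k y' t.
Proof.
move=> yy'; have [lt_tT|le_Tt] := ltnP t T.
  rewrite !encode_data // /data (@state_causal _ _ y y') // => s lt_st; apply: yy'; lia.
have rr : make_report m d y = make_report m d y'.
  by apply: make_report_causal => s lt_s; apply: yy'; lia.
have [->|neq_tT] := eqVneq t T; first by rewrite !encode_key1.
have [->|neq_tT1] := eqVneq t T.+1; first by rewrite !encode_key2.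
have [->|neq_tT2] := eqVneq t T.+2; first by rewrite !encode_report rr.
by rewrite !encode_tag ?rr /tag ?yy' //; lia.
Qed.

(** The tag uses sums over all links, including [U], so agreement off [U] does not force it: its
    equality is a separate assumption, made for the tag slot only. *)
Lemma encode_shift U m m' d k k' y y' t i : (D <= #|U|)%N -> (t < n)%N ->
  clean_data m d U y (minn t T) -> clean_data m' (shift U m m' d) U y' (minn t T) ->
  (forall s j, (s < t)%N -> j \notin U -> y s j 0 = y' s j 0) ->
  (forall j, j \notin U -> k.1 j 0 = k'.1 j 0 /\ k.2 j 0 = k'.2 j 0) ->
  (t = T.+3 -> tag y (embed (make_report m d y)) =
               tag y' (embed (make_report m' (shift U m m' d) y'))) ->
  i \notin U -> encode m d k y t i 0 = encode m' (shift U m m' d) k' y' t i 0.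
Proof.
move=> DU lt_t clean clean' yy' kk' tags iU; have [lt_tT|le_Tt] := ltnP t T.
  move: clean clean'; rewrite (minn_idPl (ltnW lt_tT)) => clean clean'.
  by rewrite !encode_data //; exact: data_shift.
move: clean clean'; rewrite (minn_idPr le_Tt) => clean clean'.
have rr : make_report m d y = make_report m' (shift U m m' d) y'.
  by apply: make_report_shift => // s j lt_s; apply: yy'; exact: leq_trans le_Tt.
have [eqt|neq_tT] := eqVneq t T; first by rewrite eqt !encode_key1 (kk' i iU).1.
have [->|neq_tT1] := eqVneq t T.+1; first by rewrite !encode_key2 (kk' i iU).2.
have [->|neq_tT2] := eqVneq t T.+2; first by rewrite !encode_report rr !mxE.
by rewrite !encode_tag ?tags ?mxE //; lia.
Qed.

Definition randomness := (padding * keys)%type.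
Implicit Type r : randomness.

Definition symbols (h : word) t : 'cV[F]_C := \col_i unrank 0 (h t i).

Definition scheme : code := Code #|F| #|{: message}| #|{: randomness}|
  (fun=> (INR #|{: randomness}|)^-1) (List.repeat 1%N n)
  (fun mi ri h t j =>
     let m : message := unrank [ffun=> 0] mi in
     let r : randomness := unrank ([ffun=> 0], (0, 0)) ri in
     rank (encode m r.1 r.2 (symbols h) t (inord j) 0))
  (fun h => rank (decode (symbols h))).

Lemma symbols_eq h h' t : (forall j, h t j = h' t j) -> symbols h t = symbols h' t.
Proof. by move=> hh'; apply/colP => i; rewrite !mxE hh'. Qed.

Lemma scheme_causal_round mi ri h h' t i :
  (forall s j, (s < rstart (c_rounds scheme) t)%coq_nat -> h s j = h' s j) ->
  c_enc scheme mi ri h t i = c_enc scheme mi ri h' t i.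
Proof.
have -> : rstart (c_rounds scheme) t = minn t n by exact: rstart_unit.
move=> hh'; congr rank; rewrite (@encode_causal _ _ _ _ (symbols h')) //.
by move=> s lt_s; apply: symbols_eq => j; apply: hh'; lia.
Qed.

Lemma randomness_gt0 : (0 < #|{: randomness}|)%N.
Proof. exact: (card_gt0 ([ffun=> 0], (0, 0))). Qed.

Lemma message_gt0 : (0 < #|{: message}|)%N.
Proof. exact: (card_gt0 [ffun=> 0]). Qed.

Lemma scheme_valid : valid_code C n scheme.
Proof.
split; first by apply/ssrnat.leP; rewrite /= card_finNzRing_gt1.
split; first by apply/ssrnat.leP; exact: message_gt0.
split; first by move=> i _; apply/RleP; rewrite /= invr_ge0 INRE ler0n.
split; first by rewrite /= fsum_const_prob // randomness_gt0.
split; first by rewrite /= n_def; apply/ssrnat.leP.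
split; first by rewrite /=; elim: n => //= t' ->.
split; first by move=> *; apply/ssrnat.ltP; exact: rank_lt.
exact: scheme_causal_round.
Qed.

Local Arguments hist : simpl never.
Local Arguments sent : simpl never.

Lemma scheme_encE mi ri h t j : c_enc scheme mi ri h t j =
  let m : message := unrank [ffun=> 0] mi in
  let r : randomness := unrank ([ffun=> 0], (0, 0)) ri in
  rank (encode m r.1 r.2 (symbols h) t (inord j) 0).
Proof. by []. Qed.

(** * Secrecy and reliability of the scheme *)

Section Attack.
Variables (a : adversary) (U : {set 'I_C}).
Hypothesis large_U : (D <= #|U|)%N.
Hypothesis reads_links : forall j, a_r a j -> (j < C)%N.
Hypothesis U_unread : forall i : 'I_C, i \in U -> ~~ a_r a i.
Hypothesis U_clean : forall i : 'I_C, i \in U -> ~~ a_w a i.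

Lemma scheme_causal mi ri h h' t i : (forall s j, (s < t)%N -> h s j = h' s j) ->
  c_enc scheme mi ri h t i = c_enc scheme mi ri h' t i.
Proof.
move=> hh'; congr rank; rewrite (@encode_causal _ _ _ _ (symbols h')) //.
by move=> s lt_s; apply: symbols_eq => j; apply: hh'; lia.
Qed.

Definition Y m r := symbols (received C scheme a n (rank m) (rank r)).

Lemma scheme_sentE m r t j : sent C scheme a n (rank m) (rank r) t j =
  rank (encode m r.1 r.2 (Y m r) t (inord j) 0).
Proof. by rewrite /sent scheme_encE !rankK. Qed.

Lemma Y_clean m r t (i : 'I_C) : (t < n)%N -> ~~ a_w a i ->
  Y m r t i 0 = encode m r.1 r.2 (Y m r) t i 0.
Proof.
move=> lt_t aw; rewrite mxE (received_clean scheme_causal) // scheme_sentE.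
by rewrite inord_val rankK.
Qed.

Lemma Y_clean_data m r t : (t <= T)%N -> clean_data m r.1 U (Y m r) t.
Proof.
move=> le_t s i lt_s /U_clean aw; rewrite Y_clean //; last by lia.
by rewrite encode_data //; exact: leq_trans le_t.
Qed.

Lemma Y_key1 m r i : i \in U -> Y m r T i 0 = r.2.1 i 0.
Proof. by move=> /U_clean aw; rewrite Y_clean ?encode_key1 //; lia. Qed.

Lemma Y_key2 m r i : i \in U -> Y m r T.+1 i 0 = r.2.2 i 0.
Proof. by move=> /U_clean aw; rewrite Y_clean ?encode_key2 //; lia. Qed.

Definition true_report m r := embed (make_report m r.1 (Y m r)).

Section Coupled.
Variables (m m' : message) (r r' : randomness).
Hypothesis shifted : r'.1 = shift U m m' r.1.
Hypothesis same_keys :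
  forall j, j \notin U -> r.2.1 j 0 = r'.2.1 j 0 /\ r.2.2 j 0 = r'.2.2 j 0.
Hypothesis same_tag :
  (forall s j, (s < T.+3)%N -> j \notin U -> Y m r s j 0 = Y m' r' s j 0) ->
  tag (Y m r) (true_report m r) = tag (Y m' r') (true_report m' r').

(** The bound on [j] matters: [inord] sends an index out of range to link 0, which may lie in
    [U]. *)
Let Un : pred nat := fun j => (j < C)%N && (inord j \in U).

(** This supplies the agreement hypothesis of the general coupling. It serves both secrecy, with two
    messages and equal keys, and the forgery count, with one message and keys that may differ on
    [U]. *)
Lemma sent_coupled t : (t < n)%N ->
  let w := received C scheme a n (rank m) (rank r) in
  let w' := received C scheme a n (rank m') (rank r') in
  (forall s j, (s < t)%N -> ~~ Un j -> w s j = w' s j) ->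
  forall j, (j < C)%N -> ~~ Un j ->
  sent C scheme a n (rank m) (rank r) t j = sent C scheme a n (rank m') (rank r') t j.
Proof.
move=> lt_t w w' ww' j lt_jC; rewrite /Un lt_jC /= => jU; rewrite !scheme_sentE; congr rank.
have YY' s i : (s < t)%N -> i \notin U -> Y m r s i 0 = Y m' r' s i 0.
  by move=> lt_s iU; rewrite !mxE; congr unrank; apply: ww'; rewrite // /Un inord_val ltn_ord.
rewrite shifted; apply: encode_shift => //.
- by apply: Y_clean_data; exact: geq_minr.
- by rewrite -shifted; apply: Y_clean_data; exact: geq_minr.
- by move=> eqt; rewrite -shifted; apply: same_tag; rewrite -eqt.
Qed.

Lemma Un_unread j : Un j -> ~~ a_r a j.
Proof. by case/andP=> lt_jC /U_unread; rewrite inordK. Qed.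

Lemma Y_coupled t i : (t < n)%N -> i \notin U -> Y m r t i 0 = Y m' r' t i 0.
Proof.
move=> lt_t iU; rewrite !mxE; congr unrank.
apply: (received_agree scheme_causal reads_links Un_unread sent_coupled (leqnn _)) => //.
by rewrite /Un inord_val ltn_ord.
Qed.

Lemma view_coupled :
  view C n scheme a (rank m) (rank r) = view C n scheme a (rank m') (rank r').
Proof. exact: (view_agree scheme_causal reads_links Un_unread sent_coupled). Qed.

End Coupled.

Definition shift_randomness m m' r : randomness := (shift U m m' r.1, r.2).

(** Only the tag needs an argument. The received keys agree on [U], where they are the common keys
    of Alice, and off [U] by coupling; the reports agree as well. *)
Lemma view_shift m m' r :
  view C n scheme a (rank m) (rank r) =
  view C n scheme a (rank m') (rank (shift_randomness m m' r)).
Proof.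
apply: view_coupled => // YY'.
have YY'T s : (s == T) || (s == T.+1) -> Y m r s = Y m' (shift_randomness m m' r) s.
  move=> eq_s; apply/colP => i; have [iU|iU] := boolP (i \in U).
    by case/orP: eq_s => /eqP->; rewrite ?Y_key1 ?Y_key2.
  by apply: YY' => //; case/orP: eq_s => /eqP->; lia.
rewrite /tag !YY'T ?eqxx ?orbT // /true_report.
suff -> : make_report m r.1 (Y m r) =
  make_report m' (shift U m m' r.1) (Y m' (shift_randomness m m' r)) by [].
apply: make_report_shift => //.
- exact: Y_clean_data.
- exact: (@Y_clean_data m' (shift_randomness m m' r)).
- by move=> s j lt_s; apply: YY'; lia.
Qed.

Lemma shift_randomness_bij m m' : bijective (shift_randomness m m').
Proof.
have K m1 m2 : cancel (shift_randomness m1 m2) (shift_randomness m2 m1).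
  move=> [d k]; congr pair; apply/ffunP => b; rewrite !ffunE -addrA -mulmxDr.
  by rewrite addrA subrK subrr mulmx0 addr0.
by exists (shift_randomness m' m).
Qed.

Lemma p_joint_scheme m v : p_joint C n scheme a (rank m) v =
  \sum_(r : randomness) (INR #|{: message}|)^-1 * (INR #|{: randomness}|)^-1 *
     (win_eqb n C (view C n scheme a (rank m) (rank r)) v)%:R.
Proof. by rewrite /p_joint fsum_rank; apply: eq_bigr => r _; rewrite indE. Qed.

(** Alice's randomness is uniform, so reindexing by the view-preserving bijection leaves the sum
    unchanged. *)
Lemma p_joint_indep m m' v :
  p_joint C n scheme a (rank m) v = p_joint C n scheme a (rank m') v.
Proof.
rewrite !p_joint_scheme [RHS](reindex (shift_randomness m m')); last first.
  exact/onW_bij/shift_randomness_bij.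
by apply: eq_bigr => r _; rewrite (view_shift m m').
Qed.

Lemma scheme_secret : perfectly_secret C n scheme a.
Proof.
move=> mi v /ssrnat.ltP lt_mi; rewrite -(unrankK [ffun=> 0] lt_mi) /p_view /= fsum_rank.
rewrite (eq_bigr (fun=> p_joint C n scheme a (rank (unrank [ffun=> 0] mi : message)) v)).
  rewrite sumr_const RmultE RinvE -[X in _ * X]mulr_natl INRE mulKf //.
  by rewrite pnatr_eq0 -lt0n message_gt0.
by move=> m _; exact: p_joint_indep.
Qed.

(** * Forged reports and the error probability *)

Definition forged m i : {set randomness} := [set r |
  (Y m r T.+2 i 0 != true_report m r) && (Y m r T.+3 i 0 == tag (Y m r) (Y m r T.+2 i 0))].

Lemma Y_report m r (i : 'I_C) : ~~ a_w a i -> Y m r T.+2 i 0 = true_report m r.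
Proof. by move=> aw; rewrite Y_clean // ?encode_report ?mxE //; lia. Qed.

(** Some link passes the check, since an untouched one carries the genuine report and tag. Without
    forgeries every link that passes carries the genuine report, so the choice made by [decode] is
    immaterial. *)
Lemma decode_correct m r : (B.+1 + C <= T)%N -> (0 < #|U|)%N ->
  (forall i, r \notin forged m i) -> decode (Y m r) = m.
Proof.
move=> le_T /card_gt0P[u uU] nf; rewrite /decode; case: pickP => [i tag_i|/(_ u)].
  have := nf i; rewrite inE tag_i andbT negbK => /eqP->.
  rewrite /true_report embedK; apply: read_reportK le_T large_U _.
  exact: Y_clean_data.
have aw : ~~ a_w a u by exact: U_clean.
have lt_n : (T.+3 < n)%N by lia.
by rewrite Y_report // Y_clean // encode_tag // mxE eqxx.
Qed.

Definition set_entry (v : 'cV[F]_C) u x : 'cV[F]_C := \col_j if j == u then x else v j 0.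

(** On forgeries this map is injective: the tag and the keys off [u] determine the
    execution outside [U], the forged tag included, hence the key by
    [affine_unique]. *)
Definition rekey m u (p : randomness * F) : randomness :=
  (p.1.1, (set_entry p.1.2.1 u (tag (Y m p.1) (true_report m p.1)), set_entry p.1.2.2 u p.2)).

Lemma total_eq_entry (v w : 'cV[F]_C) u : total v = total w ->
  (forall j, j != u -> v j 0 = w j 0) -> v u 0 = w u 0.
Proof.
move=> eq_tot vw; move: eq_tot; rewrite /total (bigD1 u) // [RHS](bigD1 u) //=.
by rewrite (eq_bigr (fun j => w j 0)) // => /addIr.
Qed.

Lemma shift_id m d : shift U m m d = d.
Proof. by apply/ffunP => b; rewrite ffunE subrr mulmx0 addr0. Qed.

Lemma set_entry_inj (v w : 'cV[F]_C) u x z : set_entry v u x = set_entry w u z ->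
  x = z /\ forall j, j != u -> v j 0 = w j 0.
Proof.
move=> /colP vw; split; first by have := vw u; rewrite !mxE eqxx.
by move=> j /negPf ju; have := vw j; rewrite !mxE ju.
Qed.

Lemma rekey_inj m i u : u \in U ->
  {in [pred p : randomness * F | p.1 \in forged m i] &, injective (rekey m u)}.
Proof.
move=> uU [r x] [r' x'] /=; rewrite !inE /= => /andP[neq /eqP tag_i] /andP[neq' /eqP tag_i'].
rewrite /rekey /= => -[eqd /set_entry_inj[eqtag eqk1] /set_entry_inj[eqx eqk2]].
have eqd' : r'.1 = shift U m m r.1 by rewrite shift_id.
have keys_off j : j \notin U -> r.2.1 j 0 = r'.2.1 j 0 /\ r.2.2 j 0 = r'.2.2 j 0.
  by move=> jU; have ju : j != u by [apply: contraNneq jU => ->]; rewrite eqk1 ?eqk2.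
(* The tag assumption of the coupling is [eqtag], which [rekey] records in the entry [u] of the
   first key. *)
have YY' t j : (t < n)%N -> j \notin U -> Y m r t j 0 = Y m r' t j 0.
  by move=> lt_t jU; exact: (@Y_coupled m m r r').
have iU : i \notin U.
  by apply: contra neq => /U_clean aw; rewrite Y_report.
have eq_rep : true_report m r = true_report m r'.
  rewrite /true_report eqd'; congr embed; apply: make_report_shift => //.
  - exact: Y_clean_data.
  - by rewrite -eqd'; apply: Y_clean_data.
  - by move=> s j lt_s; apply: YY'; lia.
have eq2 : Y m r T.+2 i 0 = Y m r' T.+2 i 0 by apply: YY' => //; lia.
have eq3 : Y m r T.+3 i 0 = Y m r' T.+3 i 0 by apply: YY' => //; lia.
rewrite eq2 eq3 {}tag_i' in tag_i; rewrite eq_rep in eqtag.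
rewrite /tag in tag_i eqtag.
(* The two keys agree on the genuine report and on the forged one, which are distinct. *)
have [totA totB] := affine_unique neq' eqtag (esym tag_i).
(* Only the entry at [u] was erased. The totals agree and so do the other received symbols, so the
   symbols at [u] agree; as [u] is not jammed, they are the original entries. *)
have eq1 : r.2.1 = r'.2.1.
  apply/colP => j; have [->|/eqk1 //] := eqVneq j u.
  rewrite -(@Y_key1 m r) // -(@Y_key1 m r') //; apply: total_eq_entry totA _ => l lu.
  have [lU|lU] := boolP (l \in U); first by rewrite !Y_key1 // eqk1.
  by apply: YY' => //; lia.
have eq2' : r.2.2 = r'.2.2.
  apply/colP => j; have [->|/eqk2 //] := eqVneq j u.
  rewrite -(@Y_key2 m r) // -(@Y_key2 m r') //; apply: total_eq_entry totB _ => l lu.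
  have [lU|lU] := boolP (l \in U); first by rewrite !Y_key2 // eqk2.
  by apply: YY' => //; lia.
rewrite eqx; congr pair; move: eqd eq1 eq2'; clear.
by case: r r' => [d [k1 k2]] [d' [k1' k2']] /= -> -> ->.
Qed.

(** Pairs of a forgery and a field element inject into the randomness, so a given link forges with
    probability at most [1 / #|F|]. *)
Lemma card_forged m i : (0 < #|U|)%N -> (#|forged m i| * #|F| <= #|{: randomness}|)%N.
Proof.
move=> /card_gt0P[u uU]; rewrite -[#|F|]cardsT -cardsX -(card_in_imset (f := rekey m u)).
  exact: max_card.
move=> [r x] [r' x'] /setXP[fp _] /setXP[fq _].
by apply: (@rekey_inj m i u uU); rewrite unfold_in.
Qed.

(** Union bound over the links that may carry a forgery. *)
Lemma card_decode_error m : (B.+1 + C <= T)%N -> (0 < #|U|)%N ->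
  (#|[set r | decode (Y m r) != m]| * #|F| <= C * #|{: randomness}|)%N.
Proof.
move=> le_T U_gt0; have sub : [set r | decode (Y m r) != m] \subset \bigcup_i forged m i.
  apply/subsetP => r; rewrite inE; apply: contraR => /bigcupP nf; apply/eqP.
  by apply: decode_correct => // i; apply/negP => fi; apply: nf; exists i.
apply: leq_trans (_ : (\sum_(i < C) #|forged m i|) * #|F| <= _)%N.
  rewrite leq_mul2r (leq_trans (subset_leq_card sub)) ?orbT //.
  elim/big_rec2: _ => [|i k A _ le_A]; first by rewrite cards0.
  exact: leq_trans (leq_card_setU _ _) (leq_add (leqnn _) le_A).
rewrite big_distrl /= -[X in (_ <= X * _)%N]card_ord -sum_nat_const.
by apply: leq_sum => i _; exact: card_forged.
Qed.

Lemma err_prob_scheme : (B.+1 + C <= T)%N -> (0 < #|U|)%N ->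
  err_prob C n scheme a <= C%:R / #|F|%:R.
Proof.
move=> le_T U_gt0; rewrite /err_prob fsum_rank.
have K_gt0 : 0 < #|{: message}|%:R :> R by rewrite ltr0n message_gt0.
have L_gt0 : 0 < #|{: randomness}|%:R :> R by rewrite ltr0n randomness_gt0.
have F_gt0 : 0 < #|F|%:R :> R by rewrite ltr0n (card_gt0 (0 : F)).
have -> : C%:R / #|F|%:R = \sum_(m : message) #|{: message}|%:R^-1 * (C%:R / #|F|%:R) :> R.
  by rewrite sumr_const -[RHS]mulr_natl mulrA divff ?mul1r // gt_eqF.
apply: ler_sum => m _; rewrite fsum_rank /= !INRE.
rewrite (eq_bigr (fun r => #|{: message}|%:R^-1 * #|{: randomness}|%:R^-1 *
  (decode (Y m r) != m)%:R)); last first.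
  move=> r _; rewrite indE natEqbE; congr (_ * (~~ _)%:R).
  by apply/eqP/eqP => [/(can_inj (rankK [ffun=> 0]))|->].
rewrite -mulr_sumr -mulrA ler_pM2l ?invr_gt0 // ler_pdivlMr // -mulrA ler_pdivrMl //.
rewrite -natr_sum -!natrM ler_nat [leqRHS]mulnC.
apply: leq_trans (card_decode_error m le_T U_gt0); rewrite -sum1dep_card [in leqRHS]big_mkcond.
by rewrite leq_mul2r leq_sum ?orbT // => r _; case: ifP => ->.
Qed.

End Attack.
End Scheme.

(** * Achievability: choice of the block length and the field *)

Definition untouched C (a : adversary) : {set 'I_C} := [set i : 'I_C | ~~ a_r a i && ~~ a_w a i].

Lemma card_untouched C q zrw zro zwo a : valid_adv C q zrw zro zwo a ->
  (C <= zrw + zro + zwo + #|untouched C a|)%N.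
Proof.
move=> [_ [_ [_ [_ [_ [_ [/ssrnat.leP rw_le [/ssrnat.leP ro_le [/ssrnat.leP wo_le _]]]]]]]]].
rewrite !nlinks_card in rw_le ro_le wo_le.
rewrite -[leqLHS]card_ord -[leqLHS](cardsC (untouched C a)) addnC leq_add2r.
set A := [set i : 'I_C | a_rw a i] in rw_le; set A' := [set i : 'I_C | a_ro a i] in ro_le.
set A'' := [set i : 'I_C | a_wo a i] in wo_le.
have sub : ~: untouched C a \subset A :|: A' :|: A''.
  apply/subsetP => i; rewrite !inE /a_r /a_w.
  by case: (a_rw a i); case: (a_ro a i); case: (a_wo a i).
apply: leq_trans (subset_leq_card sub) _.
apply: leq_trans (leq_card_setU _ _) (leq_add _ wo_le).
exact: leq_trans (leq_card_setU _ _) (leq_add rw_le ro_le).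
Qed.

Lemma Rpower_nat (q k : nat) : (0 < q)%N -> Rpower (INR q) (INR k) = INR (q ^ k)%N.
Proof.
move=> q_gt0; rewrite Rpower_pow; first by rewrite RpowE !INRE natrX.
by apply/RltP; rewrite INRE ltr0n.
Qed.

Lemma large_finField k : exists F : finFieldType, (k < #|F|)%N.
Proof.
have [p lt_kp p_prime] := prime_above k.
by exists 'F_p; rewrite card_Fp.
Qed.

Lemma rate_achievable C' zrw zro zwo D (rate : R) :
  (0 < D)%N -> (zrw + zro + zwo + D = C'.+1)%N -> rate < D%:R ->
  achievable C'.+1 zrw zro zwo rate.
Proof.
set C := C'.+1 => D_gt0 CE lt_rate eps /RltP eps_gt0.
have gap_gt0 : 0 < D%:R - rate by rewrite subr_gt0.
(* The overhead is [C + 4] slots: [C] possible retransmissions and the four final slots. Beyond [x]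
   the remaining [n - (C + 4)] blocks of [D] symbols still give the required rate. *)
pose x : R := D%:R * (C + 4)%:R / (D%:R - rate).
exists (C + 5 + Num.bound x)%N => n /ssrnat.leP le_n.
pose B := (n - (C + 5))%N; pose T := (B.+1 + C)%N.
have n_def : n = T.+4 by rewrite /T /B; lia.
(* The three terms make room for a report in one symbol, for [C] distinct evaluation points, and for
   an error bound [C / #|F|] below [eps]. *)
pose big := (#|{: report C' B T}| + C + Num.bound (C%:R / eps))%N.
have [F lt_F] := large_finField big.
have F_gt0 : (0 < #|F|)%N by lia.
have C_le : (C <= #|F|)%N by lia.
have fits : (#|{: report C' B T}| <= #|F|)%N by lia.
pose alpha : 'rV[F]_C := \row_i unrank 0 i.
have alpha_inj : injective (alpha 0).
  move=> i j; rewrite !mxE => /(congr1 (@rank _)); rewrite !unrankK; first exact: val_inj.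
  - exact: leq_trans (ltn_ord j) C_le.
  - exact: leq_trans (ltn_ord i) C_le.
have /fin_all_exists[L LP] : forall W : {set 'I_C}, exists L : 'M[F]_(C, D),
    (D <= #|W|)%N -> Vandermonde D alpha *m L = 1%:M /\ forall i k, i \notin W -> L i k = 0.
  (* Sets with fewer than [D] links receive the default matrix 0. *)
  move=> W; have [DW|_] := boolP (D <= #|W|)%N; last by exists 0.
  by have [L0 L0P] := vandermonde_right_inverse alpha_inj DW; exists L0.
have mulGL W DW := (LP W DW).1.
have L_support (W : {set 'I_C}) i k DW := (LP W DW).2 i k.
exists (@scheme F C' D B T (Vandermonde D alpha) L n); split; first exact: scheme_valid.
split.
  rewrite /= card_ffun card_mx card_ord muln1 -expnM -Rpower_nat //.
  apply: Rle_Rpower; first by apply/RleP; rewrite INRE ler1n.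
  apply/RleP; rewrite !INRE RmultE.
  have lt_x : x < n%:R.
    apply: lt_le_trans (archi_boundP _) _; first exact: divr_ge0 (mulr_ge0 (ler0n _ _) (ler0n _ _)) (ltW gap_gt0).
    by rewrite ler_nat; lia.
  move: lt_x; rewrite /x ltr_pdivrMr // => lt_x.
  have -> : (D * B.+1)%:R = D%:R * (n%:R - (C + 4)%:R) :> R.
    by rewrite -natrB ?natrM; [congr (_ * _%:R); lia|lia].
  by rewrite mulrBr [D%:R * n%:R]mulrC lerBrDr -lerBrDl -mulrBr ltW.
move=> a adv; have le_U := card_untouched adv.
have [rw_lt [ro_lt _]] := adv.
have reads_links j : a_r a j -> (j < C)%N.
  by case/orP => [/rw_lt|/ro_lt] /ssrnat.ltP.
have large_U : (D <= #|untouched C a|)%N by lia.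
have unread i : i \in untouched C a -> ~~ a_r a i by rewrite inE => /andP[].
have clean i : i \in untouched C a -> ~~ a_w a i by rewrite inE => /andP[].
split; last exact: (scheme_secret mulGL L_support n_def fits large_U reads_links unread clean).
apply/RltP; apply: le_lt_trans (_ : C%:R / #|F|%:R < eps).
  exact: (err_prob_scheme mulGL L_support n_def fits large_U reads_links unread clean _
            (leq_trans D_gt0 large_U)).
rewrite ltr_pdivrMr ?ltr0n // -ltr_pdivrMl // mulrC.
apply: lt_trans (archi_boundP _) _; first by rewrite divr_ge0 // ltW.
by rewrite ltr_nat; apply: leq_ltn_trans lt_F; exact: leq_addl.
Qed.

(** A code with a single message; it settles the case where no link is left to the scheme. *)
Lemma zero_achievable C zrw zro zwo : achievable C zrw zro zwo 0.
Proof.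
move=> eps eps_gt0; exists 0%N => n _.
exists (Code 2 1 1 (fun=> 1) [:: n] (fun _ _ _ _ _ => 0%N) (fun=> 0%N)).
split; last split.
- split; first by apply/ssrnat.leP.
  split; first by apply/ssrnat.leP.
  split; first by move=> i _; apply/RleP; exact: ler01.
  split; first by rewrite fsumE big_ord1.
  split; first by apply/ssrnat.leP.
  split; first exact: addn0.
  by split=> // *; apply/ssrnat.ltP.
- by rewrite RmultE mulr0 Rpower_O; [exact: Rle_refl|apply: lt_0_INR; apply/ssrnat.ltP].
move=> a _; split.
  by rewrite /err_prob !fsumE !big_ord1 !fsumE big_ord1 indE natEqbE eqxx RmultE mulr0.
move=> m v /ssrnat.ltP; rewrite ltnS leqn0 => /eqP->.
by rewrite /p_view !fsumE /= big_ord1 RmultE RinvE invr1 mul1r.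
Qed.

(** * Converse *)

(** For fixed side information [u] the guess depends on the view alone, which is independent of the
    uniform message, so it is right with probability at most [1 / M]. Success implies that some [u]
    guesses right, and a union bound over [U] concludes. *)
Lemma guess_bound (K : realFieldType) (M L : nat) (V U : finType) (w : 'I_L -> K)
    (vw : 'I_M -> 'I_L -> V) (ok : 'I_M -> 'I_L -> bool) (g : U -> V -> nat) :
  let p m v := \sum_r M%:R^-1 * w r * (vw m r == v)%:R in
  (0 < M)%N -> (forall r, 0 <= w r) -> \sum_r w r = 1 ->
  (forall m v, p m v = M%:R^-1 * \sum_m' p m' v) ->
  (forall m r, ok m r -> exists u, g u (vw m r) = m) ->
  \sum_m \sum_r M%:R^-1 * w r * (ok m r)%:R <= #|U|%:R / M%:R.
Proof.
move=> p M_gt0 w_ge0 w1 indep okP.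
have Mi_ge0 : 0 <= M%:R^-1 :> K by rewrite invr_ge0 ler0n.
have Mw_ge0 r : 0 <= M%:R^-1 * w r by rewrite mulr_ge0.
have p_ge0 m v : 0 <= p m v by apply: sumr_ge0 => r _; rewrite mulr_ge0 ?ler0n.
have sum_p : \sum_v \sum_m p m v = 1.
  rewrite exchange_big /= (eq_bigr (fun=> M%:R^-1)).
    by rewrite sumr_const card_ord -[LHS]mulr_natr mulVf // pnatr_eq0 -lt0n.
  move=> m _; rewrite exchange_big /= -[RHS]mulr1 -[X in _ = _ * X]w1 mulr_sumr; apply: eq_bigr => r _.
  rewrite -mulr_sumr (bigD1 (vw m r)) //= eqxx /= big1 ?addr0 ?mulr1 // => v.
  by rewrite eq_sym => /negPf->.
have bound u : \sum_m \sum_r M%:R^-1 * w r * (g u (vw m r) == m)%:R <= M%:R^-1.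
  have -> : \sum_m \sum_r M%:R^-1 * w r * (g u (vw m r) == m)%:R =
            \sum_v \sum_(m < M) (g u v == m)%:R * p m v.
    rewrite [RHS]exchange_big; apply: eq_bigr => m _.
    under [RHS]eq_bigr do rewrite mulr_sumr.
    rewrite [RHS]exchange_big; apply: eq_bigr => r _.
    rewrite (bigD1 (vw m r)) //= eqxx /= mulr1 mulrC big1 ?addr0 // => v.
    by rewrite eq_sym => /negPf->; rewrite !mulr0.
  rewrite -[leRHS]mulr1 -[X in _ <= _ * X]sum_p mulr_sumr; apply: ler_sum => v _.
  under eq_bigr do rewrite indep.
  rewrite -mulr_suml ler_piMl ?mulr_ge0 ?sumr_ge0 //.
  (* At most one message equals the guess, and none does if the guess is out of range. *)
  have [lt_g|le_g] := ltnP (g u v) M.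
    rewrite (bigD1 (Ordinal lt_g)) //= eqxx /= big1 ?addr0 // => m neq_m.
    by case: eqP => // e; case/eqP: neq_m; apply: val_inj; rewrite /= e.
  rewrite big1 ?ler01 // => m _; case: eqP => // e.
  by move: (ltn_ord m); rewrite -e ltnNge le_g.
apply: le_trans (_ : \sum_(u : U) M%:R^-1 <= _); last by rewrite sumr_const mulr_natl.
apply: le_trans (ler_sum _ (fun u _ => bound u)); rewrite [leRHS]exchange_big /=.
apply: ler_sum => m _; rewrite [leRHS]exchange_big /=; apply: ler_sum => r _.
rewrite -mulr_sumr ler_wpM2l //; case ok_mr: (ok m r); last by rewrite sumr_ge0.
have [u gu] := okP _ _ ok_mr; rewrite (bigD1 u) //= gu eqxx /= lerDl.
by rewrite sumr_ge0.
Qed.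

Section FiniteWords.
Variables (n k q : nat).

(** Words form an infinite type; their windows, as finite tables, can be summed over and counted. *)
Definition word_table (f : word) : {ffun 'I_n * 'I_k -> 'I_q.+1} :=
  [ffun p : 'I_n * 'I_k => inord (f p.1 p.2)].

Definition table_word (v : {ffun 'I_n * 'I_k -> 'I_q.+1}) : word := fun s j =>
  if (insub s : option 'I_n, insub j : option 'I_k) is (Some s', Some j') then v (s', j') else 0%N.

Lemma word_tableK f : (forall s j, (s < n)%N -> (j < k)%N -> (f s j < q.+1)%N) ->
  (forall s j, ~~ ((s < n)%N && (j < k)%N) -> f s j = 0%N) -> table_word (word_table f) = f.
Proof.
move=> f_lt f_out; apply: word_ext => s j; rewrite /table_word.
case: insubP => [s' s_lt <-|s_ge]; last by rewrite f_out // (negPf s_ge).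
case: insubP => [j' j_lt <-|j_ge]; last by rewrite f_out // (negPf j_ge) andbF.
by rewrite ffunE /= inordK // f_lt.
Qed.

Lemma table_word_window v f : (forall s j, (s < n)%N -> (j < k)%N -> (f s j < q.+1)%N) ->
  win_eqb n k f (table_word v) = (word_table f == v).
Proof.
move=> f_lt; apply/win_eqbP/eqP => [fv|<- s j lt_s lt_j].
  apply/ffunP => -[s j]; apply: val_inj; rewrite ffunE /= inordK ?f_lt //.
  by rewrite fv // /table_word !valK.
by rewrite /table_word !insubT /= ffunE /= inordK // f_lt.
Qed.

End FiniteWords.

Lemma nlinks_interval C x k : (nlinks C (fun i => (x <= i < x + k)%N) <= k)%N.
Proof.
rewrite /nlinks list_seqE -{2}(size_iota x k).
apply: (@uniq_leq_size _ (filter (fun i => (x <= i < x + k)%N) (iota 0 C))).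
  by rewrite filter_uniq // iota_uniq.
by move=> i; rewrite mem_filter !mem_iota => /andP[].
Qed.

Section Converse.
Variables (C n zrw zro zwo : nat) (c : code).
Hypothesis Hz : (zrw + zro + zwo <= C)%N.
Hypothesis c_valid : valid_code C n c.
Let D := (C - (zrw + zro + zwo))%N.

(** Three consecutive intervals of full size, all written in the shape of [nlinks_interval], hence
    the explicit zeros. *)
Definition blocker : adversary := Adv
  (fun i => (0 <= i < 0 + zrw)%N) (fun i => (zrw <= i < zrw + zro)%N)
  (fun i => (zrw + zro <= i < zrw + zro + zwo)%N) (fun _ _ _ => 0%N).

Lemma blocker_valid : valid_adv C (c_q c) zrw zro zwo blocker.
Proof.
have [/ssrnat.leP q_gt1 _] := c_valid.
split; first by move=> i /= ?; apply/ssrnat.ltP; lia.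
split; first by move=> i /= ?; apply/ssrnat.ltP; lia.
split; first by move=> i /= ?; apply/ssrnat.ltP; lia.
split; first by move=> i; apply/negbTE/negP => /andP[] /=; lia.
split; first by move=> i; apply/negbTE/negP => /andP[] /=; lia.
split; first by move=> i; apply/negbTE/negP => /andP[] /=; lia.
split; first by apply/ssrnat.leP; exact: nlinks_interval.
split; first by apply/ssrnat.leP; exact: nlinks_interval.
split; first by apply/ssrnat.leP; exact: nlinks_interval.
by move=> *; apply/ssrnat.ltP; exact: ltnW.
Qed.

Lemma valid_causal m rho h h' t i : (forall s j, (s < t)%N -> h s j = h' s j) ->
  c_enc c m rho h t i = c_enc c m rho h' t i.
Proof.
have [_ [_ [_ [_ [_ [_ [_ causal]]]]]]] := c_valid.
move=> hh'; apply: causal => s j /ssrnat.ltP lt_s; apply: hh'.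
exact: leq_trans lt_s (rstart_from_le _ (leq0n t)).
Qed.

Lemma valid_sent_lt a m rho s j : (s < n)%N -> (j < C)%N -> (sent C c a n m rho s j < c_q c)%N.
Proof.
have [_ [_ [_ [_ [_ [_ [enc_lt _]]]]]]] := c_valid.
by move=> lt_s lt_j; apply/ssrnat.ltP/enc_lt; apply/ssrnat.ltP.
Qed.

(** The links below [zrw + zro] that are not overwritten are the read-only ones, so the view
    contains them. *)
Definition assemble q (v : {ffun 'I_n * 'I_C -> 'I_q.+1}) (u : {ffun 'I_n * 'I_D -> 'I_q.+1}) : word :=
  fun s j => if a_w blocker j then 0%N
             else if (j < zrw + zro)%N then table_word v s j
             else table_word u s (j - (zrw + zro + zwo))%N.

(** Instance of [guess_bound]: the guess decodes the assembled word, and the side information that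
    makes it right is the true content of the [D] untouched links. *)
Lemma success_bound : perfectly_secret C n c blocker ->
  1 - err_prob C n c blocker <= (c_q c ^ (n * D))%:R / (c_K c)%:R.
Proof.
move=> secret; have [/ssrnat.leP q_gt1 [/ssrnat.leP K_gt0 [w_ge0 [w_sum _]]]] := c_valid.
have [q q_def] : exists q, c_q c = q.+1 by exists (c_q c).-1; rewrite prednK // ltnW.
have reads_links j : a_r blocker j -> (j < C)%N by rewrite /a_r /=; lia.
have recv_lt m r s j : (s < n)%N -> (j < C)%N -> (received C c blocker n m r s j < q.+1)%N.
  move=> lt_s lt_j; rewrite (receivedE _ valid_causal) //; case: ifP => //= _.
  by rewrite -q_def valid_sent_lt.
have view_lt m r s j : (s < n)%N -> (j < C)%N -> (view C n c blocker m r s j < q.+1)%N.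
  by move=> lt_s lt_j; rewrite (viewE _ _ _ valid_causal); case: ifP => // _; rewrite -q_def valid_sent_lt.
have view_out m r s j : ~~ ((s < n)%N && (j < C)%N) -> view C n c blocker m r s j = 0%N.
  rewrite (viewE _ _ _ valid_causal); case: ltnP => //= _.
  by case: ifP => // /reads_links ->.
pose vw m r := word_table n C q (view C n c blocker m r).
pose rest m r : word := fun s j => received C c blocker n m r s (zrw + zro + zwo + j)%N.
have viewK m r : table_word (vw m r) = view C n c blocker m r.
  by apply: word_tableK => s j; [exact: view_lt|exact: view_out].
have restK m r : table_word (word_table n D q (rest m r)) = rest m r.
  apply: word_tableK => s j => [lt_s lt_j|out]; first by apply: recv_lt => //; lia.
  by apply: received_outside; apply: contra out; lia.
have receivedK m r : received C c blocker n m r = assemble (vw m r) (word_table n D q (rest m r)).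
  apply: word_ext => s j; rewrite /assemble viewK restK; case: ifP => aw.
    have [/andP[lt_s lt_j]|] := boolP ((s < n)%N && (j < C)%N).
      by rewrite (receivedE _ valid_causal) // aw.
    exact: received_outside.
  case: ltnP => lt_j; last first.
    by rewrite /rest subnKC //; move: aw; rewrite /a_w /=; lia.
  have lt_jC : (j < C)%N by lia.
  rewrite (viewE _ _ _ valid_causal); case: ltnP => [lt_s|le_s] /=; last first.
    by apply: received_outside; rewrite ltnNge le_s.
  rewrite (received_clean valid_causal) ?aw // ifT //.
  by move: aw; rewrite /a_w /a_r /=; lia.
pose ok (m : 'I_(c_K c)) (r : 'I_(c_L c)) := c_dec c (received C c blocker n m r) == m.
have p_jointE (m : 'I_(c_K c)) v : p_joint C n c blocker m (table_word v) =
    \sum_(r < c_L c) (c_K c)%:R^-1 * c_w c r * (vw m r == v)%:R.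
  rewrite /p_joint fsumE; apply: eq_bigr => r _.
  by rewrite indE table_word_window ?INRE //; exact: view_lt.
have -> : 1 - err_prob C n c blocker =
    \sum_(m < c_K c) \sum_(r < c_L c) (c_K c)%:R^-1 * c_w c r * (ok m r)%:R.
  apply/eqP; rewrite subr_eq; apply/eqP.
  rewrite /err_prob fsumE -big_split /=.
  transitivity (\sum_(m < c_K c) (c_K c)%:R^-1 : R).
    by rewrite sumr_const card_ord -[RHS]mulr_natr mulVf // pnatr_eq0 -lt0n.
  apply: eq_bigr => m _; rewrite fsumE -big_split /=.
  rewrite -[LHS]mulr1 -[X in _ * X = _]w_sum fsumE mulr_sumr; apply: eq_bigr => r _.
  rewrite indE natEqbE INRE !RmultE RinvE -mulrDr /ok.
  by case: (_ == _); rewrite /= ?addr0 ?add0r mulr1.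
have -> : (c_q c ^ (n * D))%N = #|{: {ffun 'I_n * 'I_D -> 'I_q.+1}}|.
  by rewrite card_ffun card_prod !card_ord q_def.
apply: (@guess_bound _ _ _ _ _ (fun r : 'I__ => c_w c r) (fun m r => vw m r) ok
         (fun u v => c_dec c (assemble v u))) => //.
- by move=> r; apply/RleP/w_ge0/ssrnat.ltP.
- by rewrite -fsumE.
- move=> m v /=; rewrite -p_jointE secret; last exact/ssrnat.ltP.
  rewrite INRE RmultE RinvE; congr (_ * _); rewrite /p_view fsumE.
  by apply: eq_bigr => m' _; rewrite p_jointE.
- by move=> m r /eqP ok_mr; exists (word_table n D q (rest m r)); rewrite /= -receivedK.
Qed.

End Converse.

(** If [rate] exceeds [D], take error 1/2 and [n] with [n * (rate - D)] at least 1. Then there are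
    at least [q ^ (n * D + 1)] messages, and since [q] is at least 2 the success probability is at
    most 1/2, a contradiction. *)
Lemma achievable_le C zrw zro zwo (rate : R) : (zrw + zro + zwo <= C)%N ->
  achievable C zrw zro zwo rate -> rate <= (C - (zrw + zro + zwo))%:R.
Proof.
move=> Hz ach; set D := (C - _)%N; rewrite leNgt; apply/negP => lt_rate.
have gap_gt0 : 0 < rate - D%:R by rewrite subr_gt0.
have /RltP half_gt0 : 0 < 2^-1 :> R by rewrite invr_gt0 ltr0n.
have [N codes] := ach _ half_gt0.
pose n := (N + Num.bound (rate - D%:R)^-1)%N.
have [|c [c_valid [large_K safe]]] := codes n; first by apply/ssrnat.leP; exact: leq_addr.
have [/RltP err_lt secret] := safe _ (blocker_valid Hz c_valid).
have le_bound := success_bound Hz c_valid secret; rewrite -/D in le_bound.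
have [/ssrnat.leP q_gt1 [/ssrnat.leP K_gt0 _]] := c_valid.
have q_gt0 : (0 < c_q c)%N by exact: ltnW.
have one_gap : (n * D).+1%:R <= n%:R * rate.
  have lt_n : (rate - D%:R)^-1 < n%:R.
    apply: lt_le_trans (archi_boundP _) _; first by rewrite invr_ge0 ltW.
    by rewrite ler_nat leq_addl.
  rewrite -natr1 natrM addrC -lerBrDr -mulrBr -ler_pdivrMr // div1r.
  exact: ltW.
have : ((c_q c) ^ (n * D).+1)%:R <= (c_K c)%:R :> R.
  rewrite -!INRE; apply/RleP; apply: Rle_trans large_K; rewrite -Rpower_nat //.
  apply: Rle_Rpower; first by apply/RleP; rewrite INRE ler1n.
  by apply/RleP; rewrite !INRE RmultE.
rewrite expnS natrM => le_K.
have K_pos : 0 < (c_K c)%:R :> R by rewrite ltr0n.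
have : 1 - err_prob C n c (blocker zrw zro zwo) <= 2^-1.
  apply: le_trans le_bound _; rewrite ler_pdivrMr // ler_pdivlMl ?ltr0n //.
  by apply: le_trans le_K; rewrite ler_wpM2r ?ler0n // ler_nat.
by rewrite lerBlDr leNgt [ltRHS]splitr div1r ltrD2l err_lt.
Qed.

Lemma capacity_bound_nat C zrw zro zwo : (zrw + zro + zwo <= C)%N ->
  Rmax 0 (INR C - INR zro - INR zwo - INR zrw) = (C - (zrw + zro + zwo))%:R.
Proof.
move=> Hz; rewrite !RminusE RmaxE !INRE.
have -> : C%:R - zro%:R - zwo%:R - zrw%:R = (C - (zrw + zro + zwo))%:R :> R.
  by rewrite natrB // !natrD; ring.
exact/max_idPr/ler0n.
Qed.

Lemma capacity_is_lub C zrw zro zwo : (zrw + zro + zwo <= C)%N ->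
  is_lub (achievable C zrw zro zwo) (Rmax 0 (INR C - INR zro - INR zwo - INR zrw)).
Proof.
move=> Hz; rewrite capacity_bound_nat //; split.
  by move=> rate /(achievable_le Hz)/RleP.
move=> b ub; apply/RleP; have [->|D_gt0] := posnP (C - (zrw + zro + zwo)).
  exact/RleP/ub/zero_achievable.
(* The scheme was shown to reach the rates strictly below [D], so the upper bound [b] is compared
   with [D - e] for every positive [e]. *)
apply/ler_addgt0Pr => e e_gt0; rewrite -lerBlDr; apply/RleP/ub.
case: C Hz ub D_gt0 => [|C'] Hz ub D_gt0; first by [].
apply: rate_achievable D_gt0 _ _; first by rewrite subnKC.
by rewrite ltrBlDr ltrDl.
Qed.

End Capacity.

Theorem theorem10 (C zrw zro zwo : nat) (Hz : (zrw + zro + zwo <= C)%nat) :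
  is_lub (achievable C zrw zro zwo)
         (Rmax 0 (INR C - INR zro - INR zwo - INR zrw)).
Proof.
exact (Capacity.capacity_is_lub (ssrbool.introT ssrnat.leP Hz)).
Qed.
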